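(* Assume monotone protection and all-or-nothing release. The release rule $D(V)=C^+(V)\setminus C_0$ is regret-free for every realized signer set $V\subseteq S$ (every public coalition it ever produces protects all of its members), and it produces the public coalition $C^+(S)$ when all supporters sign ($V=S$). The difference $m(C^+(S))-m(C^-(S))$ is nonnegative, and it is strictly positive if and only if $C^-(S)\subsetneq C^+(S)$, equivalently if and only if $\Gamma$ has more than one fixed point.
   Context: Setting. $C_0$ (the vanguard, possibly empty) and $N$ are disjoint finite sets of people; $S\subseteq N$ is the set of supporters. Each $i\in C_0\cup N$ has mass $a_i>0$, and $m(C)=\sum_{i\in C}a_i$. A coalition is a set $C$ with $C_0\subseteq C\subseteq C_0\cup S$. For each $i\in C_0\cup S$ a protection family $\mathcal P_i$ is given, consisting of coalitions that contain $i$. Standing assumption: $C_0\in\mathcal P_i$ for every $i\in C_0$. Monotone protection: for all $i$ and all coalitions $C\subseteq C'$ with $C\in\mathcal P_i$, also $C'\in\mathcal P_i$. A coalition $C$ is self-protecting if $C\in\mathcal P_i$ for every $i\in C$. Operators on coalitions: $T(C)=C\cup\{i\in S\setminus C: C\cup\{i\}\in\mathcal P_i\}$ and $\Gamma(C)=C_0\cup\{i\in S: C\cup\{i\}\in\mathcal P_i\}$. $C^-(S)=T^{|S|}(C_0)$. For $W\subseteq S$, $C^+(W)$ is the union of all self-protecting coalitions $C$ with $C_0\subseteq C\subseteq C_0\cup W$. Release: $V\subseteq S$ is the set of people whose valid signatures the administrator has received. A release rule assigns a subset $D(V)\subseteq V$ whose endorsements are published. All signatures are private before release and unreleased signatures stay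 private. All-or-nothing release: the endorsements in $D(V)$ are published in one single event, so that the public coalition is $C_0$ before the release and $C_0\cup D(V)$ after it, with no intermediate public coalition. *)

(* Defs.v *)
From HB Require Import structures.
From mathcomp Require Import all_boot all_order all_algebra.

Set Implicit Arguments.
Unset Strict Implicit.
Unset Printing Implicit Defensive.

Import Order.TTheory GRing.Theory Num.Theory.
Local Open Scope ring_scope.

(* [I] is any finite type containing the people. [mass] and [protection] are
   total functions, but the values [mass i] for [i] outside
   [vanguard :|: people], and [protection i] for [i] outside
   [vanguard :|: supporters], are junk and never used. *)
Record movement (R : realFieldType) (I : finType) := Movement {
  vanguard : {set I};
  people : {set I};
  supporters : {set I};
  mass : I -> R;
  protection : I -> {set {set I}};
  vanguard_disjoint : [disjoint vanguard & people];
  supporters_sub : supporters \subset people;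
  mass_gt0 : forall i, i \in vanguard :|: people -> 0 < mass i;
  protection_coalition : forall i C,
    i \in vanguard :|: supporters -> C \in protection i ->
    [/\ vanguard \subset C, C \subset vanguard :|: supporters & i \in C];
  vanguard_protected : forall i, i \in vanguard -> vanguard \in protection i
}.

Definition coalition (R : realFieldType) (I : finType) (M : movement R I)
    (C : {set I}) : bool :=
  (vanguard M \subset C) && (C \subset vanguard M :|: supporters M).

Definition total_mass (R : realFieldType) (I : finType) (M : movement R I)
    (C : {set I}) : R :=
  \sum_(i in C) mass M i.

Definition monotone_protection (R : realFieldType) (I : finType)
    (M : movement R I) : Prop :=
  forall (i : I) (C C' : {set I}),
    i \in vanguard M :|: supporters M ->
    coalition M C -> coalition M C' -> C \subset C' ->
    C \in protection M i -> C' \in protection M i.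

Definition self_protecting (R : realFieldType) (I : finType)
    (M : movement R I) (C : {set I}) : bool :=
  coalition M C && [forall i in C, C \in protection M i].

Definition T_op (R : realFieldType) (I : finType) (M : movement R I)
    (C : {set I}) : {set I} :=
  C :|: [set i in supporters M :\: C | i |: C \in protection M i].

Definition Gamma (R : realFieldType) (I : finType) (M : movement R I)
    (C : {set I}) : {set I} :=
  vanguard M :|: [set i in supporters M | i |: C \in protection M i].

Definition Gamma_fixed_points (R : realFieldType) (I : finType)
    (M : movement R I) : {set {set I}} :=
  [set C | coalition M C & Gamma M C == C].

Definition Cminus (R : realFieldType) (I : finType) (M : movement R I) :
    {set I} :=
  iter #|supporters M| (T_op M) (vanguard M).

Definition Cplus (R : realFieldType) (I : finType) (M : movement R I)
    (W : {set I}) : {set I} :=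
  \bigcup_(C : {set I} | [&& vanguard M \subset C,
                             C \subset vanguard M :|: W
                           & self_protecting M C]) C.

Definition is_release_rule (R : realFieldType) (I : finType)
    (M : movement R I) (D : {set I} -> {set I}) : Prop :=
  forall V : {set I}, V \subset supporters M -> D V \subset V.

(* A release schedule maps the set [V] of received signatures to the
   chronological list of publication events, each being the set of
   endorsements published in that event. *)
Definition schedule (I : finType) := {set I} -> seq {set I}.

(* All successive public coalitions, starting with the one before any event. *)
Definition public_coalitions (R : realFieldType) (I : finType)
    (M : movement R I) (events : seq {set I}) : seq {set I} :=
  vanguard M :: scanl (@setU I) (vanguard M) events.

Definition final_coalition (R : realFieldType) (I : finType)
    (M : movement R I) (events : seq {set I}) : {set I} :=
  last (vanguard M) (public_coalitions M events).

Definition all_or_nothing (R : realFieldType) (I : finType)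
    (M : movement R I) (D : {set I} -> {set I}) (sched : schedule I) : Prop :=
  forall V : {set I}, V \subset supporters M -> sched V = [:: D V].

Definition regret_free (R : realFieldType) (I : finType)
    (M : movement R I) (sched : schedule I) : Prop :=
  forall V : {set I}, V \subset supporters M ->
  forall C : {set I}, C \in public_coalitions M (sched V) ->
  self_protecting M C.

Definition Cplus_rule (R : realFieldType) (I : finType) (M : movement R I)
    (V : {set I}) : {set I} :=
  Cplus M V :\: vanguard M.

(* Main.v *)
(** By monotone protection, self-protecting coalitions are closed under union
    and under adding a member who accepts the enlarged coalition.  Hence
    [Cplus M (supporters M)] is the largest fixed point of [Gamma].  The
    iterates of [T_op] from the vanguard are self-protecting, stay below every
    fixed point, and stabilize within [#|supporters M|] steps since each strict
    step recruits a supporter; so [Cminus M] is the least fixed point. *)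
Require Import Defs.
From HB Require Import structures.
From mathcomp Require Import all_boot all_order all_algebra.

Set Implicit Arguments.
Unset Strict Implicit.
Unset Printing Implicit Defensive.

Import Order.TTheory GRing.Theory Num.Theory.
Local Open Scope ring_scope.

(** * Self-protecting coalitions and their unions *)

Lemma self_protectingP (R : realFieldType) (I : finType) (M : movement R I)
    (C : {set I}) :
  reflect (coalition M C /\ forall i, i \in C -> C \in protection M i)
          (self_protecting M C).
Proof.
apply: (iffP andP) => -[cC pC]; split=> //.
  by move=> i iC; move/forall_inP: pC; apply.
exact/forall_inP.
Qed.

Lemma coalition_vanguard (R : realFieldType) (I : finType) (M : movement R I) :
  coalition M (vanguard M).
Proof. by rewrite /coalition subxx subsetUl. Qed.

Lemma self_protecting_vanguard (R : realFieldType) (I : finType)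
    (M : movement R I) :
  self_protecting M (vanguard M).
Proof.
apply/self_protectingP; split; first exact: coalition_vanguard.
exact: vanguard_protected.
Qed.

Lemma coalitionU1 (R : realFieldType) (I : finType) (M : movement R I)
    (C : {set I}) (i : I) :
  coalition M C -> i \in supporters M -> coalition M (i |: C).
Proof.
case/andP=> sVC sCVS iS; rewrite /coalition subUset sub1set inE iS orbT sCVS.
by rewrite (subset_trans sVC) ?subsetUr.
Qed.

Lemma self_protecting_extend (R : realFieldType) (I : finType)
    (M : movement R I) (C C' : {set I}) (i : I) :
  monotone_protection M -> self_protecting M C -> coalition M C' ->
  C \subset C' -> i \in C -> C' \in protection M i.
Proof.
move=> Hmono /self_protectingP[cC pC] cC' sCC' iC.
apply: (Hmono i C C') => //; last exact: pC.
by case/andP: cC => _ /subsetP; apply.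
Qed.

Lemma vanguard_sub_Cplus (R : realFieldType) (I : finType) (M : movement R I)
    (W : {set I}) :
  vanguard M \subset Cplus M W.
Proof.
apply: (bigcup_sup (vanguard M)).
by rewrite subxx subsetUl self_protecting_vanguard.
Qed.

Lemma Cplus_sub (R : realFieldType) (I : finType) (M : movement R I)
    (W : {set I}) :
  Cplus M W \subset vanguard M :|: W.
Proof. by apply/bigcupsP => C /and3P[]. Qed.

(** Each member of the union already lies in some self-protecting [C] of the family, and
    monotonicity carries its protection from [C] up to the union. *)
Lemma self_protecting_Cplus (R : realFieldType) (I : finType)
    (M : movement R I) (W : {set I}) :
  monotone_protection M -> W \subset supporters M ->
  self_protecting M (Cplus M W).
Proof.
move=> Hmono sWS.
have cP : coalition M (Cplus M W).
  by rewrite /coalition vanguard_sub_Cplus (subset_trans (Cplus_sub _ _)) ?setUS.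
apply/self_protectingP; split=> // i /bigcupP[C hC iC].
apply: (@self_protecting_extend _ _ _ C) => //; first by case/and3P: hC.
exact: (bigcup_sup C).
Qed.

Lemma self_protecting_sub_Cplus (R : realFieldType) (I : finType)
    (M : movement R I) (C : {set I}) :
  self_protecting M C -> C \subset Cplus M (supporters M).
Proof.
move=> spC; apply: (bigcup_sup C); rewrite spC andbT.
by case/self_protectingP: spC.
Qed.

Lemma vanguardU_Cplus_rule (R : realFieldType) (I : finType)
    (M : movement R I) (V : {set I}) :
  vanguard M :|: Cplus_rule M V = Cplus M V.
Proof.
by rewrite /Cplus_rule setDE setUIr setUCr setIT; apply/setUidPr/vanguard_sub_Cplus.
Qed.

(** * Fixed points of [Gamma] *)

Lemma self_protecting_sub_Gamma (R : realFieldType) (I : finType)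
    (M : movement R I) (C : {set I}) :
  self_protecting M C -> C \subset Gamma M C.
Proof.
case/self_protectingP=> /andP[_ sCVS] pC; apply/subsetP=> i iC.
move: (subsetP sCVS i iC); rewrite !inE => /orP[-> //|->].
by rewrite (setUidPr _) ?pC ?orbT ?sub1set.
Qed.

Lemma Gamma_fixed_self_protecting (R : realFieldType) (I : finType)
    (M : movement R I) (C : {set I}) :
  monotone_protection M -> C \in Gamma_fixed_points M -> self_protecting M C.
Proof.
move=> Hmono; rewrite inE => /andP[cC /eqP fC].
apply/self_protectingP; split=> // i iC.
move: (iC); rewrite -{1}fC !inE => /orP[iV|/andP[_]]; last first.
  by rewrite (setUidPr _) // sub1set.
apply: (@self_protecting_extend _ _ _ (vanguard M)) => //.
  exact: self_protecting_vanguard.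
by case/andP: cC.
Qed.

Lemma Cplus_Gamma_fixed (R : realFieldType) (I : finType) (M : movement R I) :
  monotone_protection M -> Cplus M (supporters M) \in Gamma_fixed_points M.
Proof.
move=> Hmono.
have spP := self_protecting_Cplus Hmono (subxx (supporters M)).
have [cP _] := self_protectingP _ _ spP.
rewrite inE cP eqEsubset self_protecting_sub_Gamma // andbT.
rewrite subUset vanguard_sub_Cplus; apply/subsetP=> i; rewrite inE => /andP[iS iP].
have cU := coalitionU1 cP iS.
(* Maximality: adding a supporter who accepts gives a self-protecting coalition again, which [Cplus]
   already contains. *)
apply/(subsetP (@self_protecting_sub_Cplus _ _ _ (i |: Cplus M (supporters M)) _)).
  apply/self_protectingP; split=> // j /setU1P[->//|jP].
  exact: (self_protecting_extend Hmono spP cU (subsetUr _ _) jP).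
exact: setU11.
Qed.

(** * Iteration of [T_op] from the vanguard *)

Lemma coalition_T_op (R : realFieldType) (I : finType) (M : movement R I)
    (C : {set I}) :
  coalition M C -> coalition M (T_op M C).
Proof.
case/andP=> sVC sCVS; rewrite /coalition /T_op (subset_trans sVC) ?subsetUl //=.
rewrite subUset sCVS; apply/subsetP=> i; rewrite !inE.
by case/andP=> /andP[_ ->]; rewrite orbT.
Qed.

(** Recruits join simultaneously although each one only tested [i |: C]; monotonicity makes the
    other recruits harmless. *)
Lemma self_protecting_T_op (R : realFieldType) (I : finType)
    (M : movement R I) (C : {set I}) :
  monotone_protection M -> self_protecting M C -> self_protecting M (T_op M C).
Proof.
move=> Hmono spC; have [cC _] := self_protectingP _ _ spC.
have cT := coalition_T_op cC.
have sCT : C \subset T_op M C by apply: subsetUl.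
apply/self_protectingP; split=> // i iT.
have [iC|niC] := boolP (i \in C).
  exact: self_protecting_extend Hmono spC cT sCT iC.
move: (iT); rewrite !inE (negPf niC) /= => /andP[iS iP].
apply: (Hmono i (i |: C)) => //; first by rewrite inE iS orbT.
  exact: coalitionU1.
by rewrite subUset sub1set iT.
Qed.

(** A recruit who accepts [i |: C] also accepts the larger [i |: F], hence lies in [Gamma M F],
    which is [F]. *)
Lemma T_op_sub_Gamma_fixed (R : realFieldType) (I : finType)
    (M : movement R I) (C F : {set I}) :
  monotone_protection M -> coalition M C -> F \in Gamma_fixed_points M ->
  C \subset F -> T_op M C \subset F.
Proof.
move=> Hmono cC; rewrite inE => /andP[cF /eqP fF] sCF.
rewrite subUset sCF; apply/subsetP=> i; rewrite !inE => /andP[/andP[_ iS] iP].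
rewrite -fF !inE iS (Hmono i (i |: C)) ?orbT ?setUS //.
- by rewrite inE iS orbT.
- exact: coalitionU1.
- exact: coalitionU1.
Qed.

Lemma self_protecting_iter_T_op (R : realFieldType) (I : finType)
    (M : movement R I) (n : nat) :
  monotone_protection M -> self_protecting M (iter n (T_op M) (vanguard M)).
Proof.
move=> Hmono; elim: n => [|n IHn] /=; first exact: self_protecting_vanguard.
exact: self_protecting_T_op.
Qed.

(** As long as the iteration has not stabilized, each step adds at least one person. The strict
    bound counts the [n.+1] steps leading to [T_op M C]. *)
Lemma iter_T_op_stable_or_large (R : realFieldType) (I : finType)
    (M : movement R I) (n : nat) :
  let C := iter n (T_op M) (vanguard M) in
  T_op M C = C \/ (#|vanguard M| + n < #|T_op M C|)%N.
Proof.
have step C : T_op M C = C \/ (#|C| < #|T_op M C|)%N.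
  have: C \subset T_op M C by apply: subsetUl.
  by rewrite subEproper => /predU1P[{2}->|/proper_card]; [left|right].
elim: n => [|n IHn] /=; first by rewrite addn0; apply: step.
case: IHn => [stable|large]; first by left; rewrite !stable.
have [stable|lt] := step (T_op M (iter n (T_op M) (vanguard M))); first by left.
by right; rewrite addnS; apply: leq_ltn_trans lt.
Qed.

Lemma Cminus_T_op_fixed (R : realFieldType) (I : finType) (M : movement R I) :
  monotone_protection M -> T_op M (Cminus M) = Cminus M.
Proof.
move=> Hmono; case: (iter_T_op_stable_or_large M #|supporters M|) => // large.
(* The iterate of index [#|supporters M|.+1] is [T_op M (Cminus M)]; being a coalition, it is too
   small for the bound in [large]. *)
have [/andP[_ /subset_leq_card small] _] := self_protectingP _ _
  (self_protecting_iter_T_op #|supporters M|.+1 Hmono).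
have := leq_trans large (leq_trans small (leq_card_setU _ _)).
by rewrite ltnn.
Qed.

Lemma Cminus_Gamma_fixed (R : realFieldType) (I : finType) (M : movement R I) :
  monotone_protection M -> Cminus M \in Gamma_fixed_points M.
Proof.
move=> Hmono.
have spC : self_protecting M (Cminus M) by apply: self_protecting_iter_T_op.
have [cC _] := self_protectingP _ _ spC.
rewrite inE cC eqEsubset self_protecting_sub_Gamma // andbT.
rewrite subUset; case/andP: (cC) => -> _ /=.
apply/subsetP=> i; rewrite inE => /andP[iS iP].
(* A supporter who accepts is either already in [Cminus M] or recruited by one more [T_op], which
   changes nothing. *)
by rewrite -Cminus_T_op_fixed // !inE iS iP !andbT orbN.
Qed.

Lemma Cminus_sub_Gamma_fixed (R : realFieldType) (I : finType)
    (M : movement R I) (F : {set I}) :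
  monotone_protection M -> F \in Gamma_fixed_points M -> Cminus M \subset F.
Proof.
move=> Hmono fF; rewrite /Cminus; elim: #|supporters M| => [|n IHn] /=.
  by move: fF; rewrite inE => /andP[/andP[]].
apply: T_op_sub_Gamma_fixed => //.
by have [] := self_protectingP _ _ (self_protecting_iter_T_op n Hmono).
Qed.

Lemma Cminus_proper_CplusE (R : realFieldType) (I : finType)
    (M : movement R I) :
  monotone_protection M ->
  (Cminus M \proper Cplus M (supporters M)) = (1 < #|Gamma_fixed_points M|)%N.
Proof.
move=> Hmono; apply/idP/card_gt1P => [ltmp|[F [G [fF fG]]]].
  exists (Cminus M), (Cplus M (supporters M)).
  rewrite Cminus_Gamma_fixed // Cplus_Gamma_fixed //; split=> //.
  by apply: contraTneq ltmp => ->; rewrite properxx.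
apply: contraNT; rewrite properEneq Cminus_sub_Gamma_fixed ?Cplus_Gamma_fixed //.
rewrite andbT negbK => /eqP emp.
(* Every fixed point is squeezed between [Cminus M] and [Cplus M (supporters M)], here assumed
   equal. *)
have collapse H : H \in Gamma_fixed_points M -> H = Cminus M.
  move=> fH; apply/eqP; rewrite eqEsubset Cminus_sub_Gamma_fixed // emp andbT.
  exact/self_protecting_sub_Cplus/Gamma_fixed_self_protecting.
by rewrite (collapse F) // (collapse G).
Qed.

(** * Masses of nested coalitions *)

Lemma total_mass_sub (R : realFieldType) (I : finType) (M : movement R I)
    (A B : {set I}) :
  A \subset B -> total_mass M B - total_mass M A = total_mass M (B :\: A).
Proof.
move=> sAB; rewrite /total_mass (big_setID A) /= (setIidPr sAB).
by rewrite addrAC subrr add0r.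
Qed.

Lemma coalition_mass_gt0 (R : realFieldType) (I : finType) (M : movement R I)
    (C : {set I}) (i : I) :
  coalition M C -> i \in C -> 0 < mass M i.
Proof.
case/andP=> _ sCVS iC; apply: mass_gt0.
exact: (subsetP (setUS _ (supporters_sub M))) (subsetP sCVS i iC).
Qed.

Lemma total_mass_setD_ge0 (R : realFieldType) (I : finType) (M : movement R I)
    (A B : {set I}) :
  coalition M B -> 0 <= total_mass M (B :\: A).
Proof.
move=> cB; apply: sumr_ge0 => i /setDP[iB _].
exact/ltW/(@coalition_mass_gt0 _ _ _ B).
Qed.

Lemma total_mass_setD_gt0 (R : realFieldType) (I : finType) (M : movement R I)
    (A B : {set I}) :
  coalition M B -> (0 < total_mass M (B :\: A)) = ~~ (B \subset A).
Proof.
move=> cB; rewrite -setD_eq0; have [->|[i iD]] := set_0Vmem (B :\: A).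
  by rewrite /total_mass big_set0 ltxx eqxx.
rewrite (_ : _ != _); last by apply/set0Pn; exists i.
(* One element of the difference has positive mass; the rest contributes a nonnegative sum. *)
rewrite /total_mass (big_setD1 i iD) /= setDDl; apply: ltr_pwDl.
  by case/setDP: iD => iB _; apply: (@coalition_mass_gt0 _ _ _ B).
exact: total_mass_setD_ge0.
Qed.

Theorem theorem3 (R : realFieldType) (I : finType) (M : movement R I)
    (sched : schedule I)
    (Hmono : monotone_protection M)
    (Haon : all_or_nothing M (Cplus_rule M) sched) :
  [/\ is_release_rule M (Cplus_rule M),
      regret_free M sched,
      final_coalition M (sched (supporters M)) = Cplus M (supporters M),
      0 <= total_mass M (Cplus M (supporters M)) - total_mass M (Cminus M)
    & (0 < total_mass M (Cplus M (supporters M)) - total_mass M (Cminus M)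
         <-> Cminus M \proper Cplus M (supporters M))
      /\ (Cminus M \proper Cplus M (supporters M)
         <-> (1 < #|Gamma_fixed_points M|)%N)].
Proof.
have fP := Cplus_Gamma_fixed Hmono.
have sub := Cminus_sub_Gamma_fixed Hmono fP.
have cP : coalition M (Cplus M (supporters M)).
  by move: fP; rewrite inE => /andP[].
rewrite total_mass_sub //; split.
- by move=> V _; rewrite subDset Cplus_sub.
(* A single event leaves two public coalitions: the vanguard before it and [Cplus M V] after it. *)
- move=> V sVS C; rewrite Haon // /public_coalitions /= vanguardU_Cplus_rule !inE.
  case/orP=> /eqP->; first exact: self_protecting_vanguard.
  exact: self_protecting_Cplus.
- by rewrite /final_coalition Haon //= vanguardU_Cplus_rule.
- exact: total_mass_setD_ge0.
- rewrite -Cminus_proper_CplusE // total_mass_setD_gt0 //.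
  (* Given the inclusion [sub], properness is exactly the failure of the reverse inclusion, the
     criterion for positive mass. *)
  by rewrite /proper sub.
Qed.
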